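(* Consider a multiply coupled PH-DAE with $k\ge2$ subsystems $$\frac{d}{dt}E_ix_i=J_iz_i(x_i)-r_i(z_i(x_i))+\hat B_i\hat u_i+\bar B_i\bar u_i,\qquad \hat y_i=\hat B_i^\top z_i(x_i),\quad \bar y_i=\bar B_i^\top z_i(x_i)\qquad(i=1,\dots,k),$$ with Hamiltonians $H_1,\dots,H_k$ and skew-symmetric coupling matrix $\hat C$, i.e. with coupling $\hat u+\hat C\hat y=0$. Set $v^\top=(v_1^\top,\dots,v_k^\top)$ for $v\in\{x,\hat u,\bar u,\hat y,\bar y\}$, $F=\operatorname{diag}(F_1,\dots,F_k)$ for $F\in\{E,J,\hat B,\bar B\}$, $z(x)^\top=(z_1(x_1)^\top,\dots,z_k(x_k)^\top)$ and $r(z(x))^\top=(r_1(z_1(x_1))^\top,\dots,r_k(z_k(x_k))^\top)$. Then the overall system reads $$\frac{d}{dt}\begin{pmatrix}E&0&0\\0&0&0\\0&0&0\end{pmatrix}\begin{pmatrix}x\\ \hat u\\ \hat y\end{pmatrix}=\begin{pmatrix}J&\hat B&0\\-\hat B^\top&0&I\\0&-I&-\hat C\end{pmatrix}\begin{pmatrix}z\\ \hat u\\ \hat y\end{pmatrix}-\begin{pmatrix}r\\0\\0\end{pmatrix}+\begin{pmatrix}\bar B\\0\\0\end{pmatrix}\bar u,\qquad \bar y=\begin{pmatrix}\bar B^\top&0&0\end{pmatrix}\begin{pmatrix}z\\ \hat u\\ \hat y\end{pmatrix},$$ where $z=z(x)$ and $r=r(z(x))$, and this system, with state $(x,\hat u,\hat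 y)$, input $\bar u$ and output $\bar y$, is a PH-DAE with Hamiltonian $H=H_1+\dots+H_k$ (i.e. $H(x,\hat u,\hat y)=\sum_{i=1}^kH_i(x_i)$).
   Context: PH-DAE. A system $\frac{d}{dt}Ex(t)=Jz(x(t))-r(z(x(t)))+Bu(t)$, $y(t)=B^\top z(x(t))$ with $E\in\mathbb{R}^{p\times n}$, $J\in\mathbb{R}^{p\times p}$, $B\in\mathbb{R}^{p\times m}$, $z:\mathbb{R}^n\to\mathbb{R}^p$, $r:\mathbb{R}^p\to\mathbb{R}^p$ is a port-Hamiltonian DAE (PH-DAE) with Hamiltonian $H\in C^1(\mathbb{R}^n,\mathbb{R})$ if there is a subspace $\mathcal V\subset\mathbb{R}^p$ such that: (i) for all intervals $\mathcal I$ and all $u:\mathcal I\to\mathbb{R}^m$ for which the system has a solution $x:\mathcal I\to\mathbb{R}^n$, $z(x(t))\in\mathcal V$ for all $t\in\mathcal I$; (ii) $v^\top Jw=-w^\top Jv$ for all $v,w\in\mathcal V$; (iii) $v^\top r(v)\ge0$ for all $v\in\mathcal V$; (iv) $\nabla H(x)=E^\top z(x)$ for all $x\in z^{-1}(\mathcal V)$. A solution is a function $x$ with $Ex$ differentiable satisfying the equation pointwise. Multiply coupled PH-DAE. This consists of $k$ PH-DAEs $\frac{d}{dt}E_ix_i=J_iz_i(x_i)-r_i(z_i(x_i))+B_iu_i$, $y_i=B_i^\top z_i(x_i)$ with Hamiltonians $H_i$, whose inputs and outputs are split as $u_i=(\hat u_i^\top,\bar u_i^\top)^\top$, $y_i=(\hat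 y_i^\top,\bar y_i^\top)^\top$, with $B_i=(\hat B_i\ \bar B_i)$ split accordingly; hats denote coupling quantities (with $\hat u_i,\hat y_i\in\mathbb{R}^{m_i}$), bars denote external ones. The subsystems are coupled by $\hat u_i+\sum_{j\neq i}\hat C_{i,j}\hat y_j=0$, $i=1,\dots,k$, with matrices $\hat C_{i,j}\in\{-1,0,1\}^{m_i\times m_j}$, and the block matrix $\hat C$ with off-diagonal blocks $\hat C_{i,j}$ and zero diagonal blocks is skew-symmetric. *)

(* Defs.v *)
From HB Require Import structures.
From mathcomp Require Export all_boot all_order all_algebra.
From mathcomp Require Export all_classical all_reals all_analysis.
Export Order.TTheory GRing.Theory Num.Theory.
Export numFieldNormedType.Exports.

#[export] Set Implicit Arguments.
#[export] Unset Strict Implicit.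
#[export] Unset Printing Implicit Defensive.

Local Open Scope classical_set_scope.
Local Open Scope ring_scope.

(* Time domains: intervals of any kind (open, closed, half-open, unbounded)
   with more than one point. On a one-point interval every function would
   vacuously have every derivative. *)
Definition time_interval (R : realType) (I : set R) : Prop :=
  is_interval I /\ exists a b, [/\ I a, I b & a < b].

(* The derivative of f at t relative to I; it is one-sided at an endpoint of I
   that belongs to I, and the values of f outside I are irrelevant. *)
Definition has_derivative_in (R : realType) (q : nat)
    (I : set R) (f : R -> 'cV[R]_q) (t : R) (l : 'cV[R]_q) : Prop :=
  (s - t)^-1 *: (f s - f t) @[s --> within I t^'] --> l.

Definition gradient (R : realType) (n : nat) (H : 'cV[R]_n -> R)
    (x : 'cV[R]_n) : 'cV[R]_n :=
  \col_i 'D_(delta_mx i 0) H x.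

Definition C1 (R : realType) (n : nat) (H : 'cV[R]_n -> R) : Prop :=
  (forall x, differentiable H x) /\ continuous (gradient H).

(* d/dt (E x) = J z(x) - r(z(x)) + B u,  y = B^T z(x),
   with state x in R^n, input u and output y in R^m, and p equations. *)
Record dae (R : realType) (n p m : nat) := Dae {
  dae_E : 'M[R]_(p, n);
  dae_J : 'M[R]_p;
  dae_B : 'M[R]_(p, m);
  dae_z : 'cV[R]_n -> 'cV[R]_p;
  dae_r : 'cV[R]_p -> 'cV[R]_p
}.

Definition solution (R : realType) (n p m : nat) (S : dae R n p m)
    (I : set R) (u : R -> 'cV[R]_m) (x : R -> 'cV[R]_n) : Prop :=
  forall t, I t ->
    has_derivative_in I (fun s => dae_E S *m x s) t
      (dae_J S *m dae_z S (x t) - dae_r S (dae_z S (x t)) + dae_B S *m u t).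

Definition output (R : realType) (n p m : nat) (S : dae R n p m)
    (I : set R) (x : R -> 'cV[R]_n) (y : R -> 'cV[R]_m) : Prop :=
  forall t, I t -> y t = (dae_B S)^T *m dae_z S (x t).

Definition ph_dae (R : realType) (n p m : nat) (S : dae R n p m)
    (H : 'cV[R]_n -> R) : Prop :=
  C1 H /\
  exists V : {vspace 'cV[R]_p},
  [/\ forall (I : set R) (u : R -> 'cV[R]_m) (x : R -> 'cV[R]_n),
        time_interval I -> solution S I u x ->
        forall t, I t -> dae_z S (x t) \in V,
      forall v w, v \in V -> w \in V ->
        v^T *m dae_J S *m w = - (w^T *m dae_J S *m v),
      forall v, v \in V -> 0 <= (v^T *m dae_r S v) 0 0
    & forall x, dae_z S x \in V -> gradient H x = (dae_E S)^T *m dae_z S x].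

(* diag(F_1, ..., F_k) for rectangular blocks ([\mxdiag] covers square blocks
   only). On the diagonal the dimensions agree, so that [conform_mx] returns
   F_i and never its default 0. *)
Definition rect_mxdiag (R : realType) (k : nat) (a b : 'I_k -> nat)
    (F : forall i, 'M[R]_(a i, b i)) : 'M[R]_(\sum_i a i, \sum_i b i) :=
  \mxblock_(i, j) (if i == j then conform_mx 0 (F i) else 0).

Definition coupling_mx (R : realType) (k : nat) (mh : 'I_k -> nat)
    (C : forall i j, 'M[R]_(mh i, mh j)) :
    'M[R]_(\sum_i mh i, \sum_i mh i) :=
  \mxblock_(i, j) (if i == j then 0 else C i j).

(* The i-th subsystem: input (uh_i, ub_i) and output (yh_i, yb_i), where h
   (hat) marks coupling quantities and b (bar) external ones. *)
Definition subsystem (R : realType) (k : nat) (n p mh mb : 'I_k -> nat)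
    (E : forall i, 'M[R]_(p i, n i)) (J : forall i, 'M[R]_(p i))
    (Bh : forall i, 'M[R]_(p i, mh i)) (Bb : forall i, 'M[R]_(p i, mb i))
    (z : forall i, 'cV[R]_(n i) -> 'cV[R]_(p i))
    (r : forall i, 'cV[R]_(p i) -> 'cV[R]_(p i)) (i : 'I_k) :
    dae R (n i) (p i) (mh i + mb i) :=
  Dae (E i) (J i) (row_mx (Bh i) (Bb i)) (z i) (r i).

(* uh_i + sum_(j <> i) C_ij yh_j = 0; the blocks C i i are never used. *)
Definition coupled (R : realType) (k : nat) (mh : 'I_k -> nat)
    (C : forall i j, 'M[R]_(mh i, mh j)) (I : set R)
    (uh yh : forall i, R -> 'cV[R]_(mh i)) : Prop :=
  forall t, I t -> forall i,
    uh i t + \sum_(j | j != i) C i j *m yh j t = 0.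

(* The state (x, uh, yh) is [col_mx x (col_mx uh yh)]. *)
Definition overall_system (R : realType) (k : nat) (n p mh mb : 'I_k -> nat)
    (E : forall i, 'M[R]_(p i, n i)) (J : forall i, 'M[R]_(p i))
    (Bh : forall i, 'M[R]_(p i, mh i)) (Bb : forall i, 'M[R]_(p i, mb i))
    (z : forall i, 'cV[R]_(n i) -> 'cV[R]_(p i))
    (r : forall i, 'cV[R]_(p i) -> 'cV[R]_(p i))
    (C : forall i j, 'M[R]_(mh i, mh j)) :
    dae R (\sum_i n i + (\sum_i mh i + \sum_i mh i))
          (\sum_i p i + (\sum_i mh i + \sum_i mh i)) (\sum_i mb i) :=
  Dae
    (block_mx (rect_mxdiag E) (row_mx 0 0)
              (col_mx 0 0)    (block_mx 0 0
                                        0 0))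
    (block_mx (\mxdiag_i J i)                   (row_mx (rect_mxdiag Bh) 0)
              (col_mx (- (rect_mxdiag Bh)^T) 0) (block_mx 0 1%:M
                                                          (- 1%:M) (- coupling_mx C)))
    (col_mx (rect_mxdiag Bb) (col_mx 0 0))
    (fun s => col_mx (\mxcol_i z i (submxcol (usubmx s) i)) (dsubmx s))
    (fun w => col_mx (\mxcol_i r i (submxcol (usubmx w) i)) (col_mx 0 0)).

Definition overall_hamiltonian (R : realType) (k : nat) (n mh : 'I_k -> nat)
    (H : forall i, 'cV[R]_(n i) -> R)
    (s : 'cV[R]_(\sum_i n i + (\sum_i mh i + \sum_i mh i))) : R :=
  \sum_i H i (submxcol (usubmx s) i).

(* Main.v *)
From HB Require Import structures.
Require Import Defs.

(* The overall system is a PH-DAE for the subspace of all (v, uh, yh) with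
   v_i in V_i, where V_i witnesses that the i-th subsystem is a PH-DAE, and
   with no condition on uh and yh. The second and third block rows have
   left-hand side d/dt 0 = 0, so they are exactly the coupling output and the
   coupling condition; hence an overall solution restricts to subsystem
   solutions, which stay in V_i. Apart from diag(J_i), the structure matrix is
   skew-symmetric everywhere because coupling_mx C is. *)

Local Open Scope classical_set_scope.
Local Open Scope ring_scope.

(** * Entrywise limits and derivatives relative to an interval *)

Lemma mx_cvgP (R : realType) (T : Type) (F : set_system T)
    {FF : Filter F} (a b : nat)
    (f : T -> 'M[R]_(a, b)) (l : 'M[R]_(a, b)) :
  f @ F --> l <-> forall i j, f s i j @[s --> F] --> l i j.
Proof.
split=> [fl i j|fl].
  exact: (continuous_cvg _ (@coord_continuous R a b i j l) fl).
apply/cvg_ballP => e e0.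
(* A matrix has finitely many entries, so the entrywise conditions hold simultaneously along the
   filter. *)
have : \forall s \near F, forall i j, ball (l i j) e (f s i j).
  apply: filter_forall => i; apply: filter_forall => j.
  by move/cvg_ballP : (fl i j); exact.
exact: filterS.
Qed.

Lemma mx_continuous (R : realType) (T : topologicalType) (a b : nat)
    (f : T -> 'M[R]_(a, b)) :
  (forall i j, continuous (fun s => f s i j)) -> continuous f.
Proof.
by move=> fc x; apply/(@mx_cvgP R T (nbhs x)) => i j; exact: fc.
Qed.

(** Some point [u] of [I] differs from [t], and by convexity the segment from [t] to [u] supplies
    points of [I] arbitrarily close to [t]. Properness is what makes derivatives relative to [I]
    unique. *)
Lemma within_dnbhs_proper (R : realType) (I : set R) (t : R) :
  time_interval I -> I t -> ProperFilter (within I t^').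
Proof.
move=> [itvI [a [b [Ia Ib ab]]]] It.
apply: Build_ProperFilter_ex => A.
have [u Iu ut] : exists2 u, I u & u != t.
  have [ta|] := eqVneq a t; last by exists a.
  by exists b => //; rewrite -ta gt_eqF.
move=> /nbhs_ballP[e /= e0 teA].
(* The bound 1 keeps [t + d * (u - t)] between [t] and [u]; the other bound keeps it within [e / 2]
   of [t], hence in the open ball. *)
pose d := Num.min 1 (e / 2 / `|u - t|).
have ut0 : 0 < `|u - t| by rewrite normr_gt0 subr_eq0.
have d0 : 0 < d by rewrite lt_min ltr01 !divr_gt0.
have d1 : d <= 1 by rewrite ge_min lexx.
exists (t + d * (u - t)); apply: teA.
- rewrite /ball /= opprD addNKr normrN normrM gtr0_norm//.
  rewrite -ltr_pdivlMr//; rewrite gt_min; apply/orP; right.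
  by rewrite ltr_pM2r ?invr_gt0// ltr_pdivrMr// ltr_pMr// ltr1n.
- rewrite -subr_eq0 addrAC subrr add0r mulf_neq0 ?subr_eq0//.
  by rewrite gt_eqF.
- have [tu|tu|/eqP] := ltgtP t u; last by rewrite eq_sym (negbTE ut).
  + apply: (itvI t u) => //; apply/andP; split.
      by rewrite lerDl mulr_ge0 ?ltW// subr_gt0.
    by rewrite addrC -lerBrDr -[leRHS]mul1r ler_wpM2r// subr_ge0 ltW.
  + apply: (itvI u t) => //; apply/andP; split.
      by rewrite addrC -lerBlDr -[leLHS]mul1r ler_wnM2r// subr_le0 ltW.
    by rewrite gerDl mulr_ge0_le0 ?subr_le0 ?(ltW d0)// ltW.
Qed.

Lemma has_derivative_inP (R : realType) (q : nat) (I : set R)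
    (f : R -> 'cV[R]_q) (t : R) (l : 'cV[R]_q) :
  has_derivative_in I f t l <->
  forall i, (s - t)^-1 * (f s i 0 - f t i 0) @[s --> within I t^'] --> l i 0.
Proof.
rewrite /has_derivative_in mx_cvgP; split => [h i|h i j].
  by have := h i 0; under eq_cvg do rewrite !mxE.
by rewrite ord1; under eq_cvg do rewrite !mxE; exact: h.
Qed.

Lemma has_derivative_in_col_mx (R : realType) (a b : nat) (I : set R)
    (f : R -> 'cV[R]_a) (g : R -> 'cV[R]_b) (t : R) (l : 'cV[R]_a)
    (m : 'cV[R]_b) :
  has_derivative_in I (fun s => col_mx (f s) (g s)) t (col_mx l m) <->
  has_derivative_in I f t l /\ has_derivative_in I g t m.
Proof.
rewrite !has_derivative_inP; split=> [h|[hf hg] i].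
  split=> i; [have := h (lshift b i)|have := h (rshift a i)].
    by under eq_cvg do rewrite !col_mxEu; rewrite col_mxEu.
  by under eq_cvg do rewrite !col_mxEd; rewrite col_mxEd.
case: (split_ordP i) => j ->.
  by under eq_cvg do rewrite !col_mxEu; rewrite col_mxEu; exact: hf.
by under eq_cvg do rewrite !col_mxEd; rewrite col_mxEd; exact: hg.
Qed.

Lemma has_derivative_in_mxcol (R : realType) (k : nat) (n : 'I_k -> nat)
    (I : set R) (f : forall i, R -> 'cV[R]_(n i)) (t : R)
    (l : forall i, 'cV[R]_(n i)) :
  has_derivative_in I (fun s => \mxcol_i f i s) t (\mxcol_i l i) <->
  forall i, has_derivative_in I (f i) t (l i).
Proof.
split=> [/has_derivative_inP h i|h].
  apply/has_derivative_inP => j; have := h (tagnat.Rank i j).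
  have E (v : forall i, 'cV[R]_(n i)) :
      (\mxcol_i v i) (tagnat.Rank i j) 0 = v i j 0.
    by rewrite -[in RHS](mxcolK v i) [RHS]mxE.
  by under eq_cvg do rewrite !E; rewrite E.
apply/has_derivative_inP => j.
under eq_cvg do rewrite !mxE.
rewrite mxE; move: (h (tagnat.sig1 j)) => /has_derivative_inP; exact.
Qed.

(** All difference quotients vanish, and limits along a proper filter are unique. This turns the
    block rows with zero left-hand side into algebraic equations. *)
Lemma has_derivative_in_cst0 (R : realType) (q : nat) (I : set R) (t : R)
    (l : 'cV[R]_q) :
  time_interval I -> I t ->
  has_derivative_in I (fun=> 0) t l <-> l = 0.
Proof.
move=> hI It; rewrite /has_derivative_in subrr.
under eq_cvg do rewrite scaler0.
have pF := within_dnbhs_proper hI It.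
split=> [h|->]; last exact: cvg_cst.
by apply: (cvg_unique (@norm_hausdorff _ _) h); exact: cvg_cst.
Qed.

(** * Gradients and the overall Hamiltonian *)

Lemma derive_gradient (R : realType) (n : nat) (H : 'cV[R]_n -> R)
    (x v : 'cV[R]_n) :
  differentiable H x -> 'D_v H x = ((gradient H x)^T *m v) 0 0.
Proof.
(* The differential is linear, so expanding [v] in the standard basis reduces it to the partial
   derivatives. *)
move=> dH; rewrite {1}[v]matrix_sum_delta deriveE// mxE raddf_sum/=.
apply: eq_bigr => i _; rewrite big_ord1 linearZ/= !mxE deriveE// mulrC.
by [].
Qed.

Section TopBlock.
Variables (R : realType) (k : nat) (n : 'I_k -> nat) (q : nat) (i : 'I_k).

(** Named so that it can carry a linear structure. It is used with the dimensions [n] for states and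
    with [p] for the vectors of the subspace. *)
Definition top_block (s : 'cV[R]_(\sum_i n i + q)) : 'cV[R]_(n i) :=
  submxcol (usubmx s) i.

Fact top_block_linear : linear top_block.
Proof. by move=> a u v; apply/matrixP => j l; rewrite !mxE. Qed.

HB.instance Definition _ := GRing.isLinear.Build R
  'cV[R]_(\sum_i n i + q) 'cV[R]_(n i) _ top_block top_block_linear.

Lemma top_block_continuous : continuous top_block.
Proof.
apply: mx_continuous => j l.
have -> : (fun s => top_block s j l) =
    (fun s => s (lshift q (tagnat.Rank i j)) l).
  by apply/funext => s; rewrite !mxE.
exact: coord_continuous.
Qed.

End TopBlock.

Lemma derive_comp_linear (R : realType) (V W : normedModType R)
    (L : {linear V -> W}) (f : W -> R) (x v : V) :
  continuous L -> differentiable f (L x) ->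
  'D_v (f \o L) x = 'D_(L v) f (L x).
Proof.
move=> cL df; have dL : differentiable L x by exact: linear_differentiable.
rewrite !deriveE//; last exact: differentiable_comp.
by rewrite diff_comp//= diff_lin.
Qed.

Lemma overall_hamiltonianE (R : realType) (k : nat) (n mh : 'I_k -> nat)
    (H : forall i, 'cV[R]_(n i) -> R) :
  @overall_hamiltonian R k n mh H = \sum_i (H i \o @top_block R k n _ i).
Proof. by apply/funext => s; rewrite fct_sumE. Qed.

Section OverallHamiltonian.
Variables (R : realType) (k : nat) (n mh : 'I_k -> nat).
Variable (H : forall i, 'cV[R]_(n i) -> R).
Arguments H : clear implicits.
Hypothesis C1H : forall i, C1 (H i).
Let Hov := @overall_hamiltonian R k n mh H.

Lemma differentiable_top_block i s :
  differentiable (H i \o @top_block R k n (\sum_i mh i + \sum_i mh i) i) s.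
Proof.
apply: differentiable_comp; last exact: (C1H i).1.
by apply: linear_differentiable; exact: top_block_continuous.
Qed.

Lemma differentiable_overall s : differentiable Hov s.
Proof.
rewrite /Hov overall_hamiltonianE; apply: differentiable_sum => i.
exact: differentiable_top_block.
Qed.

Lemma derive_overall s v :
  'D_v Hov s =
  \sum_i ((gradient (H i) (top_block i s))^T *m top_block i v) 0 0.
Proof.
rewrite /Hov overall_hamiltonianE derive_sum => [|i].
  apply: eq_bigr => i _; rewrite -derive_gradient; last exact: (C1H i).1.
  apply: derive_comp_linear; first exact: top_block_continuous.
  exact: (C1H i).1.
exact/diff_derivable/differentiable_top_block.
Qed.

Lemma C1_overall : C1 Hov.
Proof.
split; first exact: differentiable_overall.
apply: mx_continuous => j l.
(* The second factor is constant in [s], so only the gradients of the [H i] along a continuous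
   projection matter for continuity. *)
have -> : (fun s => gradient Hov s j l) = (fun s => \sum_i \sum_a
    gradient (H i) (top_block i s) a 0 * top_block i (delta_mx j 0) a 0).
  apply/funext => s; rewrite mxE derive_overall; apply: eq_bigr => i _.
  by rewrite mxE; apply: eq_bigr => a _; rewrite mxE.
apply: continuous_big => [|i _]; first exact: add_continuous.
apply: continuous_big => [|a _]; first exact: add_continuous.
move=> s; apply: (@cvgM _ _ (nbhs s)); last exact: cvg_cst.
apply: (@continuous_comp _ _ _ (fun s => gradient (H i) (top_block i s))
  (fun M : 'cV[R]_(n i) => M a 0)); last exact: coord_continuous.
apply: (@continuous_comp _ _ _ (@top_block _ _ _ _ i) (gradient (H i))).
  exact: top_block_continuous.
exact: (C1H i).2.
Qed.

End OverallHamiltonian.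

(** * Block matrix algebra and product subspaces *)

Lemma mul_rect_mxdiag_mxcol (R : realType) (k : nat) (a b : 'I_k -> nat)
    (c : nat) (F : forall i, 'M[R]_(a i, b i)) (v : forall i, 'M[R]_(b i, c)) :
  rect_mxdiag F *m \mxcol_i v i = \mxcol_i (F i *m v i).
Proof.
rewrite /rect_mxdiag mul_mxblock_mxrow; apply: eq_mxcol => i.
rewrite (bigD1 i)//= eqxx conform_mx_id big1 ?addr0// => j.
by case: eqVneq => //=; rewrite mul0mx.
Qed.

Lemma tr_rect_mxdiag (R : realType) (k : nat) (a b : 'I_k -> nat)
    (F : forall i, 'M[R]_(a i, b i)) :
  (rect_mxdiag F)^T = rect_mxdiag (fun i => (F i)^T).
Proof.
rewrite /rect_mxdiag tr_mxblock; apply: eq_mxblock => i j.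
by case: (eqVneq j i) => [->|ij]; rewrite ?eqxx ?trmx0// !conform_mx_id.
Qed.

Lemma coupling_mx_mxcol (R : realType) (k : nat) (mh : 'I_k -> nat) (c : nat)
    (C : forall i j, 'M[R]_(mh i, mh j)) (v : forall i, 'M[R]_(mh i, c)) :
  coupling_mx C *m \mxcol_i v i =
  \mxcol_i (\sum_(j | j != i) C i j *m v j).
Proof.
rewrite /coupling_mx mul_mxblock_mxrow; apply: eq_mxcol => i.
rewrite (bigD1 i)//= eqxx mul0mx add0r; apply: eq_bigr => j ji.
by rewrite eq_sym (negPf ji).
Qed.

(** A 1 x 1 matrix equals its transpose. *)
Lemma skew_mulmx (R : realType) (q : nat) (K : 'M[R]_q) (v w : 'cV[R]_q) :
  K^T = - K -> v^T *m K *m w = - (w^T *m K *m v).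
Proof.
move=> KT; transitivity ((w^T *m K^T *m v)^T).
  by rewrite !trmx_mul !trmxK mulmxA.
by rewrite KT mulmxN mulNmx [- _]mx11_scalar tr_scalar_mx -mx11_scalar.
Qed.

(** The product of the [V i] with the full space of dimension [q] is encoded as an intersection of
    preimages under the block projections, which is a subspace by construction. *)
Lemma mem_top_blocks (R : realType) (k : nat) (p : 'I_k -> nat) (q : nat)
    (V : forall i, {vspace 'cV[R]_(p i)}) (w : 'cV[R]_(\sum_i p i + q)) :
  w \in (\bigcap_i (linfun (@top_block R k p q i) @^-1: V i))%VS <->
  forall i, top_block i w \in V i.
Proof.
rewrite memvE; split=> [/subv_bigcapP h i|h].
  by have := h i isT; rewrite -memvE -memv_preim lfunE.
by apply/subv_bigcapP => i _; rewrite -memvE -memv_preim lfunE; exact: h.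
Qed.

Lemma dot_mxcol (R : realType) (k : nat) (p : 'I_k -> nat)
    (v w : forall i, 'cV[R]_(p i)) :
  (\mxcol_i v i)^T *m \mxcol_i w i = \sum_i (v i)^T *m w i.
Proof. by rewrite tr_mxcol mul_mxrow_mxcol. Qed.

Lemma mxcol_eq0 (R : realType) (k : nat) (p : 'I_k -> nat)
    (v : forall i, 'cV[R]_(p i)) :
  \mxcol_i v i = 0 <-> forall i, v i = 0.
Proof. by rewrite -mxcol0; apply: iff_sym; exact: eq_mxcolP. Qed.

(** * Solutions of the overall system *)

Section OverallSystem.
Variables (R : realType) (k : nat) (n p mh mb : 'I_k -> nat).
Variables (E : forall i, 'M[R]_(p i, n i)) (J : forall i, 'M[R]_(p i)).
Variables (Bh : forall i, 'M[R]_(p i, mh i)) (Bb : forall i, 'M[R]_(p i, mb i)).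
Variables (z : forall i, 'cV[R]_(n i) -> 'cV[R]_(p i)).
Variables (r : forall i, 'cV[R]_(p i) -> 'cV[R]_(p i)).
Variable (C : forall i j, 'M[R]_(mh i, mh j)).
Arguments E : clear implicits.
Arguments z : clear implicits.
Arguments r : clear implicits.
Let S := overall_system E J Bh Bb z r C.
Let Ssub := subsystem E J Bh Bb z r.

Lemma overall_E (x : forall i, 'cV[R]_(n i))
    (w : 'cV[R]_(\sum_i mh i + \sum_i mh i)) :
  dae_E S *m col_mx (\mxcol_i x i) w = col_mx (\mxcol_i (E i *m x i)) 0.
Proof.
rewrite mul_block_col row_mx0 col_mx0 block_mx_const !mul0mx !addr0.
by rewrite mul_rect_mxdiag_mxcol.
Qed.

Lemma overall_z (x : forall i, 'cV[R]_(n i))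
    (w : 'cV[R]_(\sum_i mh i + \sum_i mh i)) :
  dae_z S (col_mx (\mxcol_i x i) w) = col_mx (\mxcol_i z i (x i)) w.
Proof.
rewrite /= col_mxKu col_mxKd; congr col_mx.
by apply: eq_mxcol => i; rewrite mxcolK.
Qed.

(** The upper block is arranged as the right-hand sides of the subsystems: [uh], multiplied by the
    structure matrix, and the input [ub] are gathered into one subsystem input. The lower blocks are
    the defects of the coupling output and of the coupling condition, the latter negated. *)
Lemma overall_rhs (zx : forall i, 'cV[R]_(p i))
    (uh yh : forall i, 'cV[R]_(mh i))
    (ub : forall i, 'cV[R]_(mb i)) :
  let w := col_mx (\mxcol_i zx i) (col_mx (\mxcol_i uh i) (\mxcol_i yh i)) in
  dae_J S *m w - dae_r S w + dae_B S *m \mxcol_i ub i =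
  col_mx
    (\mxcol_i (J i *m zx i - r i (zx i)
                + row_mx (Bh i) (Bb i) *m col_mx (uh i) (ub i)))
    (col_mx (\mxcol_i (yh i - (Bh i)^T *m zx i))
            (\mxcol_i - (uh i + \sum_(j | j != i) C i j *m yh j))).
Proof.
rewrite /= col_mxKu mul_block_col mul_row_col mul_block_col !mul_col_mx.
rewrite !mul0mx !mul1mx !mulNmx mul1mx tr_rect_mxdiag coupling_mx_mxcol.
rewrite mul_mxdiag_mxcol !mul_rect_mxdiag_mxcol !opp_col_mx !add_col_mx.
rewrite oppr0 !addr0 !add0r.
rewrite -!mxcolN -!mxcolD.
congr col_mx.
  apply: eq_mxcol => i; rewrite mxcolK mul_row_col.
  by rewrite -!addrA; congr (_ + _); rewrite addrCA.
congr col_mx; apply: eq_mxcol => i; first by rewrite addrC.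
by rewrite opprD.
Qed.

Lemma overall_solutionP (I : set R) (x : forall i, R -> 'cV[R]_(n i))
    (uh yh : forall i, R -> 'cV[R]_(mh i)) (ub : forall i, R -> 'cV[R]_(mb i)) :
  time_interval I ->
  solution S I (fun t => \mxcol_i ub i t)
    (fun t => col_mx (\mxcol_i x i t)
                (col_mx (\mxcol_i uh i t) (\mxcol_i yh i t))) <->
  [/\ forall i, solution (Ssub i) I (fun t => col_mx (uh i t) (ub i t)) (x i),
      forall t, I t -> forall i, yh i t = (Bh i)^T *m z i (x i t)
    & coupled C I uh yh].
Proof.
move=> hI.
(* The equivalence is proved at a fixed time first; quantifying over [t] then distributes over the
   three conditions. *)
have key t : I t -> has_derivative_in I (fun s => dae_E S *m
      col_mx (\mxcol_i x i s) (col_mx (\mxcol_i uh i s) (\mxcol_i yh i s))) t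
    (let w := col_mx (\mxcol_i z i (x i t))
                (col_mx (\mxcol_i uh i t) (\mxcol_i yh i t)) in
     dae_J S *m w - dae_r S w + dae_B S *m \mxcol_i ub i t) <->
  [/\ forall i, has_derivative_in I (fun s => E i *m x i s) t
        (J i *m z i (x i t) - r i (z i (x i t))
         + row_mx (Bh i) (Bb i) *m col_mx (uh i t) (ub i t)),
      forall i, yh i t = (Bh i)^T *m z i (x i t)
    & forall i, uh i t + \sum_(j | j != i) C i j *m yh j t = 0].
  move=> It; cbv zeta; rewrite overall_rhs.
  have -> : (fun s => dae_E S *m
      col_mx (\mxcol_i x i s) (col_mx (\mxcol_i uh i s) (\mxcol_i yh i s))) =
      (fun s => col_mx (\mxcol_i (E i *m x i s)) 0).
    by apply/funext => s; rewrite overall_E.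
  rewrite has_derivative_in_col_mx has_derivative_in_mxcol.
  rewrite has_derivative_in_cst0//.
  rewrite -col_mx0; split=> [[hx /eq_col_mx[/mxcol_eq0 hy /mxcol_eq0 hu]]|].
    split=> // i; first by apply/eqP; rewrite -subr_eq0; exact/eqP/hy.
    by apply: oppr_inj; rewrite oppr0; exact: hu.
  move=> [hx hy hu]; split=> //; congr col_mx; apply/mxcol_eq0 => i.
    by rewrite hy subrr.
  by rewrite hu oppr0.
have sol : solution S I (fun t => \mxcol_i ub i t)
    (fun t => col_mx (\mxcol_i x i t)
                (col_mx (\mxcol_i uh i t) (\mxcol_i yh i t))) <->
    forall t, I t -> has_derivative_in I (fun s => dae_E S *m
      col_mx (\mxcol_i x i s) (col_mx (\mxcol_i uh i s) (\mxcol_i yh i s))) t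
    (let w := col_mx (\mxcol_i z i (x i t))
                (col_mx (\mxcol_i uh i t) (\mxcol_i yh i t)) in
     dae_J S *m w - dae_r S w + dae_B S *m \mxcol_i ub i t).
  by rewrite /solution; split=> h t It; move: (h t It); rewrite overall_z.
rewrite sol; split=> [h|[hx hy hu] t It].
  by split=> [i t|t|t] It; have /key[] := h t It.
by apply/key => //; split=> // i; [exact: hx|exact: hy|exact: hu].
Qed.

End OverallSystem.

(** The structure matrix without [J]. It is separated because it is skew-symmetric as a matrix,
    whereas each [J i] is assumed skew only on its subspace. *)
Definition overall_skew (R : realType) (k : nat) (p mh : 'I_k -> nat)
    (Bh : forall i, 'M[R]_(p i, mh i)) (C : forall i j, 'M[R]_(mh i, mh j)) :
    'M[R]_(\sum_i p i + (\sum_i mh i + \sum_i mh i)) :=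
  block_mx 0                              (row_mx (rect_mxdiag Bh) 0)
           (col_mx (- (rect_mxdiag Bh)^T) 0)
           (block_mx 0 1%:M (- 1%:M) (- coupling_mx C)).

Lemma tr_overall_skew (R : realType) (k : nat) (p mh : 'I_k -> nat)
    (Bh : forall i, 'M[R]_(p i, mh i)) (C : forall i j, 'M[R]_(mh i, mh j)) :
  (coupling_mx C)^T = - coupling_mx C ->
  (overall_skew Bh C)^T = - overall_skew Bh C.
Proof.
move=> hC; rewrite /overall_skew !tr_block_mx tr_row_mx tr_col_mx !opp_block_mx.
rewrite opp_row_mx opp_col_mx !linearN/= !trmxK !trmx0 !oppr0 trmx1 !opprK hC.
by rewrite opprK.
Qed.

Theorem corollary13 (R : realType) (k : nat) (hk : (2 <= k)%N)
    (n p mh mb : 'I_k -> nat)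
    (E : forall i, 'M[R]_(p i, n i)) (J : forall i, 'M[R]_(p i))
    (Bh : forall i, 'M[R]_(p i, mh i)) (Bb : forall i, 'M[R]_(p i, mb i))
    (z : forall i, 'cV[R]_(n i) -> 'cV[R]_(p i))
    (r : forall i, 'cV[R]_(p i) -> 'cV[R]_(p i))
    (H : forall i, 'cV[R]_(n i) -> R)
    (C : forall i j, 'M[R]_(mh i, mh j))
    (hS : forall i, ph_dae (subsystem E J Bh Bb z r i) (H i))
    (hC : forall i j, i != j ->
       forall a b, C i j a b \in [:: -1; 0; 1])
    (hskew : (coupling_mx C)^T = - coupling_mx C) :
  (forall (I : set R) (x : forall i, R -> 'cV[R]_(n i))
      (uh yh : forall i, R -> 'cV[R]_(mh i))
      (ub yb : forall i, R -> 'cV[R]_(mb i)),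
    time_interval I ->
    [/\ forall i, solution (subsystem E J Bh Bb z r i) I
                    (fun t => col_mx (uh i t) (ub i t)) (x i),
        forall i, output (subsystem E J Bh Bb z r i) I (x i)
                    (fun t => col_mx (yh i t) (yb i t))
      & coupled C I uh yh] <->
    (let S := overall_system E J Bh Bb z r C in
     let s t := col_mx (\mxcol_i x i t)
                  (col_mx (\mxcol_i uh i t) (\mxcol_i yh i t)) in
     solution S I (fun t => \mxcol_i ub i t) s /\
     output S I s (fun t => \mxcol_i yb i t))) /\
  ph_dae (overall_system E J Bh Bb z r C) (@overall_hamiltonian R k n mh H).
Proof.
split=> [I x uh yh ub yb hI|].
  rewrite /= overall_solutionP//.
  (* The singleton [[set t]] makes [output] a statement about the single time [t]; no derivative
     occurs in it. *)
  have outov t : output (overall_system E J Bh Bb z r C) [set t]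
      (fun t => col_mx (\mxcol_i x i t)
                  (col_mx (\mxcol_i uh i t) (\mxcol_i yh i t)))
      (fun t => \mxcol_i yb i t) <->
      forall i, yb i t = (Bb i)^T *m z i (x i t).
    rewrite /output; split=> [/(_ t erefl)|h _ ->]; rewrite overall_z/=.
      rewrite tr_col_mx mul_row_col tr_col_mx !trmx0 row_mx0 mul0mx addr0.
      by rewrite tr_rect_mxdiag mul_rect_mxdiag_mxcol => /eq_mxcolP.
    rewrite tr_col_mx mul_row_col tr_col_mx !trmx0 row_mx0 mul0mx addr0.
    by rewrite tr_rect_mxdiag mul_rect_mxdiag_mxcol; apply/eq_mxcolP.
  (* The coupling half of a subsystem output is an equation of the overall system; the external half
     belongs to the overall output. *)
  have outsub i t : col_mx (yh i t) (yb i t) =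
      (row_mx (Bh i) (Bb i))^T *m z i (x i t) <->
      yh i t = (Bh i)^T *m z i (x i t) /\ yb i t = (Bb i)^T *m z i (x i t).
    by rewrite tr_row_mx mul_col_mx; split=> [/eq_col_mx//|[-> ->]].
  split=> [[hx hy hu]|[[hx hy hu] ho]].
    split; first by split=> // t It i; have /outsub[] := hy i t It.
    move=> t It; apply: (iffRL (outov t)) => // i.
    by have /outsub[] := hy i t It.
  split=> // i t It; apply/outsub; split; first exact: hy.
  by apply: (iffLR (outov t)) => _ ->; exact: ho.
split; first by apply: C1_overall => i; exact: (hS i).1.
(* Choosing a witness for every [i] yields a family of subspaces. *)
pose V i := projT1 (cid (hS i).2).
have hV i := projT2 (cid (hS i).2).
exists (\bigcap_i (linfun (@top_block R k p _ i) @^-1: V i))%VS; split.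
- move=> I u s hI sol t It; apply/mem_top_blocks => i.
  (* An arbitrary input and state are cut into blocks to match the form required by
     [overall_solutionP]. *)
  have uE : u = fun t => \mxcol_i submxcol (u t) i.
    by apply/funext => t'; rewrite submxcolK.
  have sE : s = fun t => col_mx (\mxcol_i top_block i (s t))
      (col_mx (\mxcol_i submxcol (usubmx (dsubmx (s t))) i)
              (\mxcol_i submxcol (dsubmx (dsubmx (s t))) i)).
    by apply/funext => t'; rewrite !submxcolK !vsubmxK.
  rewrite uE sE in sol.
  have [hx _ _] := (overall_solutionP _ _ _ _ _ _ _ _ _ _ _ hI).1 sol.
  have [h _ _ _] := hV i.
  have := h I _ _ hI (hx i) t It.
  by rewrite /top_block/= col_mxKu mxcolK.
- move=> v w /mem_top_blocks hv /mem_top_blocks hw.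
  (* The sum changes sign under exchange by property (ii) of each subsystem on [V i], the remaining
     term by skew-symmetry on all vectors. *)
  have form a b : a^T *m dae_J (overall_system E J Bh Bb z r C) *m b =
      \sum_i (top_block i a)^T *m J i *m top_block i b
      + a^T *m overall_skew Bh C *m b.
    rewrite [dae_J _](_ : _ = block_mx (\mxdiag_i J i) 0 0 0
                              + overall_skew Bh C); last first.
      by rewrite add_block_mx !add0r addr0.
    rewrite mulmxDr mulmxDl; congr (_ + _).
    rewrite -[in LHS](vsubmxK a) -[in LHS](vsubmxK b) -mulmxA mul_block_col.
    rewrite !mul0mx !addr0 tr_col_mx mul_row_col mulmx0 addr0.
    rewrite -[usubmx a]submxcolK -[usubmx b]submxcolK mul_mxdiag_mxcol.
    rewrite dot_mxcol.
    by apply: eq_bigr => i _; rewrite mulmxA.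
  rewrite !form (skew_mulmx v w (tr_overall_skew Bh hskew)) opprD -sumrN.
  congr (_ + _); apply: eq_bigr => i _.
  by have [_ h _ _] := hV i; apply: h; [exact: hv|exact: hw].
- move=> v /mem_top_blocks hv.
  (* The lower blocks of the overall [r] vanish, leaving a sum of the nonnegative subsystem
     terms. *)
  rewrite -[X in X^T]vsubmxK -[X in (col_mx X _)^T]submxcolK /= tr_col_mx.
  rewrite mul_row_col col_mx0 mulmx0 addr0 dot_mxcol summxE.
  by apply: sumr_ge0 => i _; have [_ _ h _] := hV i; apply: h; exact: hv.
- move=> s /mem_top_blocks hs; apply/colP => j.
  rewrite mxE (derive_overall (fun i => (hS i).1)).
  rewrite -[in RHS](vsubmxK s) -[usubmx s]submxcolK overall_z.
  set zs := col_mx _ _.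
  (* Entry [j] is read as [zs] paired with [E] applied to the basis vector [delta_mx j 0]. Both
     sides then become sums over subsystems, and directions in [uh] or [yh] need no separate case,
     as their top blocks are zero. *)
  transitivity ((zs^T *m (dae_E (overall_system E J Bh Bb z r C)
      *m delta_mx j (0 : 'I_1))) 0 0); last first.
    by rewrite mulmxA -colE -[zs in RHS]trmxK -trmx_mul !mxE.
  rewrite -[in RHS](vsubmxK (delta_mx j 0)) -[X in col_mx X (dsubmx _)]submxcolK
    overall_E.
  rewrite tr_col_mx mul_row_col mulmx0 addr0 dot_mxcol summxE.
  apply: eq_bigr => i _; have [_ _ _ h] := hV i.
  have := hs i; rewrite /top_block/= col_mxKu mxcolK => /h ->.
  by rewrite trmx_mul trmxK mulmxA.
Qed.
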